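(* Let $M$ be a countable structure, and let $G \leq \mathrm{Sym}(M)$ be a Polish group such that $\mathcal{K}_G$ has JEP and WAP. Then there exists a weakly $\mathcal{K}_G$-injective $\Phi \in G$.
   Context: $M$ is a countable first-order structure and $G\le\mathrm{Sym}(M)$ a group of permutations of $M$ which is Polish in the topology of pointwise convergence. A map $S:A\to B$ between substructures of $M$ is $G$-extendable if some $g\in G$ extends it. For a map $f$, $\mathrm{zdef}(f)=\mathrm{dom}(f)\cup\mathrm{rng}(f)$. $\mathcal{K}_G$ is the family of all $G$-extendable bijections between finitely generated substructures of $M$. For partial maps $S,T$ on $M$, an embedding of $S$ into $T$ is a $G$-extendable injection $\phi$ whose domain is a substructure of $M$ containing $\mathrm{zdef}(S)$ with $\phi(S(x))=T(\phi(x))$ for $x\in\mathrm{dom}(S)$. $S\le T$ means $S\subseteq T$ as graphs. JEP: any $S,T\in\mathcal{K}_G$ embed into a common $U\in\mathcal{K}_G$. WAP: for every $S\in\mathcal{K}_G$ there are $T\in\mathcal{K}_G$ and an embedding $\tau:S\to T$ such that for all $U,V\in\mathcal{K}_G$ and embeddings $\phi:T\to U$, $\psi:T\to V$ there are $W\in\mathcal{K}_G$ and embeddings $\phi':U\to W$, $\psi':V\to W$ with $\phi'\circ\phi\circ\tau=\psi'\circ\psi\circ\tau$ on $\mathrm{zdef}(S)$. A partial map $\Phi$ on $M$ (e.g. an element of $G$, or a union of a chain in $\mathcal{K}_G$) is $\mathcal{K}_G$-universal if every element of $\mathcal{K}_G$ embeds into $\Phi$, and weakly $\mathcal{K}_G$-injective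 if it is $\mathcal{K}_G$-universal and for every $S\in\mathcal{K}_G$ with $S\le\Phi$ there is $T\in\mathcal{K}_G$ with $S\le T\le\Phi$ such that for every $U\in\mathcal{K}_G$ with $T\le U$ there is an embedding $\phi:U\to\Phi$ with $\phi\restriction\mathrm{dom}(S)=\mathrm{Id}_{\mathrm{dom}(S)}$.
   Formalization: The formal theorem additionally assumes that every element of G preserves the function and constant symbols of M (no condition for relational M); without it the claim fails, since K_G may contain continuum many maps that cannot all embed into one element of G. *)

(* Defs.v *)
From HB Require Import structures.
From mathcomp Require Import all_boot all_order all_algebra.
From mathcomp Require Import all_classical all_reals all_analysis.

Set Implicit Arguments.
Unset Strict Implicit.
Unset Printing Implicit Defensive.

Local Open Scope classical_set_scope.

(** First-order structures. Constants are operations of arity 0. *)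

Record signature := Signature {
  fsym : Type;
  farity : fsym -> nat;
  rsym : Type;
  rarity : rsym -> nat }.

Record structure (L : signature) (M : Type) := Structure {
  fint : forall f : fsym L, (farity f).-tuple M -> M;
  rint : forall r : rsym L, set ((rarity r).-tuple M) }.

(* The empty set counts as a substructure when there are no constants. *)
Definition substructure (L : signature) (M : countType) (St : structure L M)
    (A : set M) : Prop :=
  forall (f : fsym L) (t : (farity f).-tuple M), [set` t] `<=` A -> A (fint St t).

Definition fg_substructure (L : signature) (M : countType)
    (St : structure L M) (A : set M) : Prop :=
  exists2 X : set M, finite_set X & A = smallest (substructure St) X.

(* Every automorphism preserves the operations; when L has no function or
   constant symbols every map does. For a group G without this property a map in
   G need not be determined on a finitely generated substructure by its values
   on generators; the family KG below can then be uncountable up to embedding,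
   with JEP and WAP but no universal element of G. *)
Definition preserves_operations (L : signature) (M : Type)
    (St : structure L M) (g : M -> M) : Prop :=
  forall (f : fsym L) (t : (farity f).-tuple M),
    g (fint St t) = fint St (map_tuple g t).

(** Polish permutation groups. *)

Definition permutation_group (M : Type) (G : set (M -> M)) : Prop :=
  [/\ forall g, G g -> bijective g,
      G id,
      forall g h, G g -> G h -> G (g \o h)
    & forall g h, G g -> cancel g h -> cancel h g -> G h].

Definition homeomorphic (S T : topologicalType) : Prop :=
  exists (f : S -> T) (g : T -> S),
    [/\ cancel f g, cancel g f, continuous f & continuous g].

Definition complete_metric (R : realType) (X : metricType R) : Prop :=
  forall F : set_system X, ProperFilter F -> cauchy F -> exists l : X, F --> l.

Definition polish (R : realType) (T : topologicalType) : Prop :=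
  (exists2 D : set T, countable D & dense D) /\
  (exists2 X : metricType R, complete_metric X & homeomorphic T X).

(* G as a topological space: the subspace topology inherited from the topology
   of pointwise convergence on M -> M, with M discrete. *)
Definition pointwise_space (M : countType) (G : set (M -> M)) : topologicalType :=
  set_type (G : set {ptws M -> discrete_topology M}).

(** Partial maps. *)

Definition pmap (M : Type) := M -> option M.

Definition pdom (M : Type) (S : pmap M) : set M :=
  [set x | exists y, S x = Some y].

Definition prng (M : Type) (S : pmap M) : set M :=
  [set y | exists x, S x = Some y].

Definition zdef (M : Type) (S : pmap M) : set M := pdom S `|` prng S.

Definition pinjective (M : Type) (S : pmap M) : Prop :=
  forall x x' y, S x = Some y -> S x' = Some y -> x = x'.

Definition ple (M : Type) (S T : pmap M) : Prop :=
  forall x y, S x = Some y -> T x = Some y.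

Definition total_pmap (M : Type) (g : M -> M) : pmap M := fun x => Some (g x).

Definition extendable (M : Type) (G : set (M -> M)) (S : pmap M) : Prop :=
  exists2 g, G g & ple S (total_pmap g).

Section KG.
Context (L : signature) (M : countType) (St : structure L M) (G : set (M -> M)).

Definition KG (S : pmap M) : Prop :=
  [/\ fg_substructure St (pdom S), fg_substructure St (prng S),
      pinjective S & extendable G S].

(* On pdom S both sides of the last equation are required to be defined: the
   left one is, because zdef S `<=` pdom phi. *)
Definition embedding (S T phi : pmap M) : Prop :=
  [/\ extendable G phi, pinjective phi, substructure St (pdom phi),
      zdef S `<=` pdom phi
    & forall x, pdom S x -> pcomp phi S x = pcomp T phi x].

Definition embeds (S T : pmap M) : Prop := exists phi, embedding S T phi.

Definition JEP : Prop :=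
  forall S T, KG S -> KG T -> exists U, [/\ KG U, embeds S U & embeds T U].

Definition WAP : Prop :=
  forall S, KG S -> exists T tau, [/\ KG T, embedding S T tau
  & forall U V phi psi,
      KG U -> KG V -> embedding T U phi -> embedding T V psi ->
      exists W phi' psi',
        [/\ KG W, embedding U W phi', embedding V W psi'
          & forall x, zdef S x ->
              pcomp phi' (pcomp phi tau) x = pcomp psi' (pcomp psi tau) x]].

Definition KG_universal (Phi : pmap M) : Prop :=
  forall S, KG S -> embeds S Phi.

Definition weakly_KG_injective (Phi : pmap M) : Prop :=
  KG_universal Phi /\
  forall S, KG S -> ple S Phi ->
    exists T, [/\ KG T, ple S T, ple T Phi
    & forall U, KG U -> ple T U ->
        exists2 phi, embedding U Phi phi
          & forall x, pdom S x -> phi x = Some x].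

End KG.

(* Main.v *)
(** Since embeddings extend to elements of [G], they are conjugations, and both
    universality and weak injectivity are intersections of countably many sets
    that are open and dense in [G]: elements of [KG] are determined by finitely
    many values, so they are countably many and extending one of them is an open
    condition. Universality is dense by JEP. By WAP every [S] in [KG] extends to
    some [T] over which extensions can be amalgamated fixing [S] pointwise;
    having such a [T] below [Phi], and mapping a given [U] above [T] into [Phi]
    by a map fixing [S], are dense conditions too. Baire's theorem is applied in
    [G] itself, so no closedness of [G] in [Sym(M)] is needed. *)

Require Import Defs.
From mathcomp Require Import all_boot all_order all_algebra.
From mathcomp Require Import all_classical all_reals all_analysis.

Set Implicit Arguments.
Unset Strict Implicit.
Unset Printing Implicit Defensive.

Import Order.TTheory GRing.Theory Num.Theory.
Local Open Scope classical_set_scope.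

(** * Baire category theorem *)

(** Nested nonempty open sets [V n] are chosen with the closure of [V n.+1] inside [V n] and [F n],
    and [V n.+1] inside a ball of radius [1/(n+1)]. They generate a Cauchy filter, whose limit lies
    in all the closures. *)
Lemma complete_metric_baire (R : realType) (X : metricType R)
    (F : nat -> set X) :
  complete_metric X -> (forall n, open (F n) /\ dense (F n)) ->
  dense (\bigcap_n F n).
Proof.
move=> Xcomplete Fod D D0 Dopen.
have shrink (nV : nat * set X) : exists V' : set X,
    open nV.2 -> nV.2 !=set0 ->
    [/\ open V', V' !=set0, closure V' `<=` nV.2 `&` F nV.1
      & exists x, V' `<=` ball x (nV.1.+1%:R^-1 : R)%R].
  case: nV => n V /=.
  have [[Vopen V0]|nV] := pselect (open V /\ V !=set0); last first.
    (* A dummy value: the choice function must be defined on all pairs, also where [V] is empty or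
       not open. *)
    by exists set0 => Vopen V0; case: nV.
  have [Fopen Fdense] := Fod n.
  have [x VFx] := Fdense V V0 Vopen.
  have VFn : nbhs x (V `&` F n).
    by apply: open_nbhs_nbhs; split=> //; exact: openI.
  (* Regularity gives a neighbourhood whose closure stays in [V] and [F n]; cutting it with a ball
     and taking the interior keeps this. *)
  have [B Bx BVF] := uniform_regular VFn.
  exists (B `&` ball x (n.+1%:R^-1 : R)%R)° => _ _; split.
  - exact: open_interior.
  - by exists x; apply: filterI => //; apply: nbhsx_ballx; rewrite invr_gt0.
  - apply: subset_trans BVF; apply: closureS.
    by apply: subset_trans (@interior_subset _ _) _ => y [].
  - by exists x => y /interior_subset [].
have [f fP] := choice shrink.
pose V := fix V n := if n is m.+1 then f (m, V m) else D.
have V_ok n : open (V n) /\ V n !=set0.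
  elim: n => [//|n [Vo V0]].
  by have [] := fP (n, V n) Vo V0.
have V_step n : closure (V n.+1) `<=` V n `&` F n.
  by have [Vo V0] := V_ok n; have [] := fP (n, V n) Vo V0.
have V_anti m n : (m <= n)%N -> V n `<=` V m.
  move=> /subnK <-; elim: (n - m)%N => [//|k IH].
  apply: subset_trans IH; rewrite addSn.
  by move=> y /subset_closure /V_step [].
have Vfilter : ProperFilter (filter_from [set: nat] V).
  apply: filter_from_proper => [|n _]; last by have [] := V_ok n.
  apply: filter_from_filter; first by exists 0%N.
  move=> m n _ _; exists (maxn m n) => // y Vy.
  by split; apply: V_anti Vy; rewrite ?leq_maxl ?leq_maxr.
have [l Vl] : exists l : X, filter_from [set: nat] V --> l.
  apply: Xcomplete; apply/cauchy_exP => e e0.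
  have [n ne] : exists n : nat, (n.+1%:R^-1 < e :> R)%R.
    exists (Num.truncn e^-1)%R.
    by rewrite -[ltRHS]invrK ltf_pV2 ?posrE ?invr_gt0// truncnS_gt.
  have [Vo V0] := V_ok n.
  have [_ _ _ [x Vx]] := fP (n, V n) Vo V0.
  exists x, n.+1 => // y /Vx; apply: le_ball; exact: ltW.
have l_cl n : closure (V n) l.
  move=> B /Vl [m _ VB].
  have [_ [y Vy]] := V_ok (maxn m n).
  exists y; split; first by apply: V_anti Vy; rewrite leq_maxr.
  by apply: VB; apply: V_anti Vy; rewrite leq_maxl.
exists l; split; first by have [] := V_step 0%N l (l_cl 1%N).
by move=> n _; have [] := V_step n l (l_cl n.+1).
Qed.

(** Open dense sets are carried through the homeomorphism to the complete metric space, and a point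
    of their intersection is carried back. *)
Lemma polish_baire (R : realType) (T : topologicalType) (F : nat -> set T) :
  polish R T -> (forall n, open (F n) /\ dense (F n)) -> dense (\bigcap_n F n).
Proof.
move=> [_ [X Xcomplete [f [g [fK gK fcont gcont]]]]] Fod D [t Dt] Dopen.
have gFod n : open (g @^-1` F n) /\ dense (g @^-1` F n).
  have [Fopen Fdense] := Fod n; split.
    by apply: open_comp => // x _; exact: gcont.
  move=> O [x Ox] Oopen.
  have [||s [Os Fs]] := Fdense (f @^-1` O).
  - by exists (g x); rewrite /preimage /= gK.
  - by apply: open_comp => // s _; exact: fcont.
  by exists (f s); split=> //; rewrite /preimage /= fK.
have gFdense : dense (\bigcap_n (g @^-1` F n)) by exact: complete_metric_baire.
have [||x [Dx Fx]] := gFdense (g @^-1` D).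
- by exists (f t); rewrite /preimage /= fK.
- by apply: open_comp => // x _; exact: gcont.
by exists (g x).
Qed.

(** * Pointwise topology and generic elements of a Polish group *)

Lemma pointwise_open_agree (M : countType) (G : set (M -> M)) (g : M -> M)
    (X : set M) :
  finite_set X ->
  open [set h : pointwise_space G | forall x, X x -> set_val h x = g x].
Proof.
move=> /finite_seqP [s ->]; elim: s => [|x s IH].
  rewrite (_ : [set h | _] = setT); first exact: openT.
  by rewrite eqEsubset; split.
have eval_cont : continuous
    ((proj x : {ptws M -> discrete_topology M} -> discrete_topology M)
      \o (set_val : pointwise_space G -> {ptws M -> discrete_topology M})).
  by move=> h; apply: continuous_comp; [exact: initial_continuous
    | exact: (@proj_continuous M (fun=> discrete_topology M))].
have open_x : open [set h : pointwise_space G | set_val h x = g x].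
  apply: (@open_comp _ _ _ [set g x : discrete_topology M]).
    by move=> h _; exact: eval_cont.
  exact: discrete_open.
rewrite (_ : [set h | _] = [set h : pointwise_space G | set_val h x = g x] `&`
   [set h | forall y, [set` s] y -> set_val h y = g y]); first exact: openI.
rewrite eqEsubset; split=> h /=.
  by move=> hg; split=> [|y ys]; apply: hg; rewrite inE ?eqxx ?ys ?orbT.
by move=> [hx hs] y; rewrite inE => /orP [/eqP -> //|]; exact: hs.
Qed.

(** The filter generated by agreement with [g] on finite sets converges to [g], which can be checked
    one coordinate at a time. *)
Lemma pointwise_nbhs_agree (M : countType) (G : set (M -> M))
    (g : pointwise_space G) (U : set (pointwise_space G)) :
  nbhs g U -> exists2 X, finite_set X &
    forall h : pointwise_space G,
      (forall x, X x -> set_val h x = set_val g x) -> U h.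
Proof.
move=> [_ [[B Bopen <-] Bg BU]].
pose N (X : set M) : set (M -> M) :=
  [set h | forall x, X x -> h x = set_val g x].
have Nfilter : Filter (filter_from finite_set N).
  apply: filter_from_filter; first by exists set0; exact: finite_set0.
  move=> X Y Xfin Yfin; exists (X `|` Y); first by rewrite finite_setU.
  by move=> h hXY; split=> x Zx; apply: hXY; [left|right].
have [X Xfin XB] : filter_from finite_set N B.
  suff : filter_from finite_set N -->
      (set_val g : {ptws M -> discrete_topology M}).
    by apply; apply: open_nbhs_nbhs; split.
  apply/cvg_sup => i V [_ [[W _ <-] Wg WV]].
  exists [set i]; first exact: finite_set1.
  by move=> h hi; apply: WV; rewrite /preimage /= hi.
by exists X => // h hX; apply: BU; exact: XB.
Qed.

(** Baire's theorem with openness and density expressed by agreement on finite sets, for a countable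
    family of conditions. *)
Lemma polish_group_generic (R : realType) (M : countType) (G : set (M -> M))
    (J : countType) (P : J -> set (M -> M)) :
  polish R (pointwise_space G) -> G !=set0 ->
  (forall i g, G g -> P i g -> exists2 X, finite_set X &
     forall h, G h -> (forall x, X x -> h x = g x) -> P i h) ->
  (forall i g X, G g -> finite_set X ->
     exists h, [/\ G h, forall x, X x -> h x = g x & P i h]) ->
  exists2 g, G g & forall i, P i g.
Proof.
move=> Gpolish [g0 Gg0] Popen Pdense.
have inG (h : pointwise_space G) : G (set_val h) by exact: set_valP.
have outG h : G h -> exists h' : pointwise_space G, set_val h' = h.
  by move=> Gh; exists (exist _ h (mem_set Gh)).
(* For [n] that codes no index, [F n] is the whole space. *)
pose F n := [set h : pointwise_space G |
  forall i, pickle_inv n = Some i -> P i (set_val h)].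
have Fod n : open (F n) /\ dense (F n).
  split.
    rewrite openE => g Fg.
    case ni : (pickle_inv (T := J) n) => [i|]; last first.
      by apply: filterS filterT => h _ j; rewrite ni.
    have [X Xfin XP] := Popen i _ (inG g) (Fg i ni).
    have := @pointwise_open_agree M G (set_val g) X Xfin.
    rewrite openE => /(_ g (fun x _ => erefl)); apply: filterS => h hX j.
    by rewrite ni => -[<-]; exact: XP.
  move=> D [g Dg] Dopen.
  have [X Xfin XD] := pointwise_nbhs_agree (open_nbhs_nbhs (conj Dopen Dg)).
  case ni : (pickle_inv (T := J) n) => [i|]; last first.
    by exists g; split=> // j; rewrite ni.
  have [h [Gh hX Ph]] := Pdense i _ X (inG g) Xfin.
  have [h' h'E] := outG h Gh; exists h'; split; first by apply: XD; rewrite h'E.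
  by move=> j; rewrite ni => -[<-]; rewrite h'E.
have [h0 _] := outG g0 Gg0.
have Fdense : dense (\bigcap_n F n) by exact: (polish_baire Gpolish).
have [||g [_ Fg]] := Fdense setT; [by exists h0|exact: openT|].
by exists (set_val g) => // i; apply: (Fg (pickle i) I i); rewrite pickleK_inv.
Qed.

(** * Generated substructures *)

Section preserved_operations.
Context (L : signature) (M : countType) (St : structure L M).

Notation gen X := (smallest (substructure St) X).

Lemma substructure_gen X : substructure St (gen X).
Proof.
move=> f t tX A [Asub XA]; apply: (Asub) => x /tX; exact.
Qed.

Lemma sub_gen (X : set M) : X `<=` gen X.
Proof. by move=> x Xx A [_]; exact. Qed.

Lemma gen_sub (X A : set M) : substructure St A -> X `<=` A -> gen X `<=` A.
Proof. by move=> Asub XA x; apply. Qed.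

Lemma gen_subset (X Y : set M) : X `<=` Y -> gen X `<=` gen Y.
Proof.
move=> XY; apply: gen_sub; first exact: substructure_gen.
by move=> x /XY; exact: sub_gen.
Qed.

(** The points where [g] and [h] agree form a substructure. *)
Lemma gen_agree (g h : M -> M) (X : set M) :
  preserves_operations St g -> preserves_operations St h ->
  (forall x, X x -> g x = h x) -> forall x, gen X x -> g x = h x.
Proof.
move=> gops hops; apply: gen_sub => f t tgh /=; rewrite gops hops.
congr (fint _ _); apply: val_inj => /=; apply/eq_in_map; exact: tgh.
Qed.

Lemma preimage_gen (g : M -> M) (X : set M) :
  preserves_operations St g -> gen X `<=` g @^-1` gen (g @` X).
Proof.
move=> gops; apply: gen_sub => [f t tX|x Xx].
  rewrite /preimage /= gops; apply: substructure_gen => _ /= /mapP [x xt ->].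
  exact: tX.
by apply: sub_gen; exists x.
Qed.

Lemma image_gen (g h : M -> M) (X : set M) :
  preserves_operations St g -> preserves_operations St h ->
  cancel g h -> cancel h g -> g @` gen X = gen (g @` X).
Proof.
move=> gops hops gK hK; rewrite eqEsubset; split.
  by move=> _ [x Xx <-]; exact: preimage_gen.
move=> y /(preimage_gen hops); rewrite /preimage /= => hy.
exists (h y); last exact: hK.
by apply: gen_subset hy => _ [_ [x Xx <-] <-]; rewrite gK.
Qed.

End preserved_operations.

(** * Elements of [KG] as restrictions of permutations in [G] *)

Definition restr (M : Type) (g : M -> M) (A : set M) : Defs.pmap M :=
  fun x => if `[< A x >] then Some (g x) else None.

Lemma restrP (M : Type) (g : M -> M) (A : set M) (x y : M) :
  restr g A x = Some y <-> A x /\ g x = y.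
Proof.
rewrite /restr; case: asboolP => Ax; first by split=> [[]|[_ ->]].
by split=> // -[].
Qed.

(* For a total permutation [g], being an embedding of [S] into [T] says that the
   conjugate of [T] by [g] extends [S]. *)
Definition conjugates (M : Type) (g : M -> M) (S T : Defs.pmap M) : Prop :=
  forall x y, S x = Some y -> T (g x) = Some (g y).

Section weakly_injective.
Context (L : signature) (M : countType) (St : structure L M) (G : set (M -> M)).
Hypothesis Ggroup : permutation_group G.
Hypothesis Gops : forall g, G g -> preserves_operations St g.

Notation gen X := (smallest (substructure St) X).
Notation KG := (KG St G).

Lemma group_inv g : G g -> exists h, [/\ G h, cancel g h & cancel h g].
Proof.
case: Ggroup => bij _ _ Ginv Gg; have [h gK hK] := bij g Gg.
by exists h; split=> //; exact: Ginv gK hK.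
Qed.

Lemma group_id : G id. Proof. by case: Ggroup. Qed.

Lemma group_comp g h : G g -> G h -> G (g \o h).
Proof. by case: Ggroup => _ _ Gcomp _; exact: Gcomp. Qed.

Lemma KG_restr g (X : set M) : G g -> finite_set X -> KG (restr g (gen X)).
Proof.
move=> Gg Xfin; have [h [Gh gK hK]] := group_inv Gg; split.
- exists X => //; rewrite eqEsubset; split=> [x [y /restrP []]//|x Xx].
  by exists (g x); apply/restrP.
- exists (g @` X); first exact: finite_image.
  rewrite -(image_gen _ (Gops Gg) (Gops Gh) gK hK) eqEsubset; split.
    by move=> y [x /restrP [Xx <-]]; exists x.
  by move=> _ [x Xx <-]; exists x; apply/restrP.
- by move=> x x' y /restrP [_ <-] /restrP [_] /(can_inj gK).
- by exists g => // x y /restrP [_ <-].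
Qed.

Lemma KG_restrE S : KG S ->
  exists g X, [/\ G g, finite_set X & S = restr g (gen X)].
Proof.
move=> [[X Xfin SX] _ _ [g Gg Sg]]; exists g, X; split=> //.
apply/funext => x; rewrite /restr; case: asboolP.
  by rewrite -SX => -[y Sxy]; rewrite Sxy; have [->] := Sg x y Sxy.
rewrite -SX => nSx; case Sx : (S x) => [y|//].
by exfalso; apply: nSx; exists y.
Qed.

(** [T'] is the conjugate of [T] by the inverse [h] of [g]; its domain is generated by the [h]-image
    of generators of the domain of [T]. *)
Lemma KG_conj g T : G g -> KG T -> exists T', KG T' /\
  forall x y, T' x = Some y <-> T (g x) = Some (g y).
Proof.
move=> Gg /KG_restrE [t [X [Gt Xfin ->]]].
have [h [Gh gK hK]] := group_inv Gg.
exists (restr (h \o t \o g) (gen (h @` X))); split.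
  apply: KG_restr; last exact: finite_image.
  by apply: group_comp => //; exact: group_comp.
move=> x y; rewrite -(image_gen _ (Gops Gh) (Gops Gg) hK gK); split.
  by move=> /restrP [[z Xz <-] <-] /=; apply/restrP; rewrite !hK.
move=> /restrP [Xgx tgx]; apply/restrP; split; first by exists (g x).
by rewrite /= tgx gK.
Qed.

(** [X] generates the domain of [S], so agreement with [g] on [X] spreads to that domain. *)
Lemma KG_open S g : KG S -> ple S (total_pmap g) -> G g ->
  exists2 X, finite_set X & forall h, G h -> (forall x, X x -> h x = g x) ->
    ple S (total_pmap h).
Proof.
move=> /KG_restrE [s [X [Gs Xfin ->]]] Sg Gg; exists X => // h Gh hg x y Sxy.
rewrite -(Sg x y Sxy) /total_pmap; congr Some.
by apply: (gen_agree (Gops Gh) (Gops Gg) hg); case/restrP: Sxy.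
Qed.

Lemma KG_enlarge S g (X : set M) :
  KG S -> ple S (total_pmap g) -> G g -> finite_set X ->
  exists P, [/\ KG P, ple S P, ple P (total_pmap g) & X `<=` pdom P].
Proof.
move=> /KG_restrE [s [Y [Gs Yfin ->]]] Sg Gg Xfin.
exists (restr g (gen (Y `|` X))); split.
- by apply: KG_restr => //; rewrite finite_setU.
- move=> x y Sxy; have [Yx _] := (restrP _ _ _ _).1 Sxy; apply/restrP; split.
    by apply: gen_subset Yx => z; left.
  by have [] := Sg x y Sxy.
- by move=> x y /restrP [_ <-].
- by move=> x Xx; exists (g x); apply/restrP; split=> //; apply: sub_gen; right.
Qed.

Lemma KG_neighborhood g (X : set M) : G g -> finite_set X ->
  exists P, [/\ KG P, ple P (total_pmap g) & X `<=` pdom P].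
Proof.
move=> Gg Xfin; exists (restr g (gen X)); split; first exact: KG_restr.
  by move=> x y /restrP [_ <-].
by move=> x Xx; exists (g x); apply/restrP; split=> //; apply: sub_gen.
Qed.

Lemma ple_agree P g h (X : set M) : ple P (total_pmap g) -> X `<=` pdom P ->
  ple P (total_pmap h) -> forall x, X x -> h x = g x.
Proof.
move=> Pg XP Ph x /XP [y Pxy].
by have [->] := Pg x y Pxy; have [] := Ph x y Pxy.
Qed.

(** A finite list of argument-value pairs on generators determines an element of [KG]. *)
Lemma KG_countable : countable KG.
Proof.
pose code S (p : seq (M * M)) := pdom S = gen [set` unzip1 p] /\
  forall x y, (x, y) \in p -> S x = Some y.
have code_inj S T p : KG S -> KG T -> code S p -> code T p -> ple S T.
  move=> [_ _ _ [s Gs Ss]] [_ _ _ [t Gt Tt]] [domS Sp] [domT Tp] x y Sxy.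
  have px : gen [set` unzip1 p] x by rewrite -domS; exists y.
  have : pdom T x by rewrite domT.
  move=> [z Txz]; rewrite Txz.
  have [<-] := Ss x y Sxy; have [<-] := Tt x z Txz; congr Some.
  apply: (gen_agree (Gops Gt) (Gops Gs) _ px) => u /= /mapP [[v w] vwp ->] /=.
  by have [->] := Tt _ _ (Tp _ _ vwp); have [->] := Ss _ _ (Sp _ _ vwp).
have has_code S : exists p, KG S -> code S p.
  have [/KG_restrE [s [X [Gs /finite_seqP [q ->] ->]]]|nS] := pselect (KG S);
    last by exists [::] => /nS.
  exists [seq (x, s x) | x <- q] => _; split.
    rewrite /unzip1 -map_comp map_id eqEsubset; split.
      by move=> x [y /restrP []].
    by move=> x qx; exists (s x); apply/restrP.
  move=> x y /mapP [z zq [-> ->]]; apply/restrP; split=> //.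
  by apply: sub_gen.
have [f fP] := choice has_code.
apply/countable_injP; exists (pickle \o f) => S T /set_mem KS /set_mem KT.
move=> /(pcan_inj pickleK) fST.
have cS := fP S KS; have cT := fP T KT; rewrite -fST in cT.
have ST := code_inj _ _ _ KS KT cS cT; have TS := code_inj _ _ _ KT KS cT cS.
apply/funext => x; case Sx : (S x) => [y|]; first by rewrite (ST _ _ Sx).
by case Tx : (T x) => [y|//]; rewrite -Sx (TS _ _ Tx).
Qed.

(** * Embeddings as conjugations, and amalgamation *)

Lemma embedding_conjugates S T phi : embedding St G S T phi ->
  exists g, [/\ G g, ple phi (total_pmap g) & conjugates g S T].
Proof.
move=> [[g Gg phig] _ _ Sphi ST]; exists g; split=> // x y Sxy.
have [x' phix] : pdom phi x by apply: Sphi; left; exists y.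
have [y' phiy] : pdom phi y by apply: Sphi; right; exists x.
have := ST x (ex_intro _ y Sxy); rewrite /pcomp Sxy phix /= phiy => y'E.
by have [->] := phig x x' phix; have [->] := phig y y' phiy.
Qed.

Lemma conjugates_embedding S T g :
  G g -> conjugates g S T -> embedding St G S T (total_pmap g).
Proof.
move=> Gg ST; have [h [_ gK _]] := group_inv Gg; split.
- by exists g.
- by move=> x x' y [<-] [] /(can_inj gK).
- by move=> f t _; exists (g (fint St t)).
- by move=> x _; exists (g x).
- by move=> x [y Sxy]; rewrite /pcomp Sxy /= (ST x y Sxy).
Qed.

Lemma zdef_ple (S T : Defs.pmap M) : ple S T -> zdef S `<=` zdef T.
Proof. by move=> ST x [[y /ST]|[y /ST]]; [left|right]; exists y. Qed.

(* Amalgamation over [S] of extensions of [T], normalized by a conjugation so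
   that it extends [U]. *)
Definition amalgamates (S T : Defs.pmap M) : Prop :=
  forall U V, KG U -> KG V -> ple T U -> ple T V ->
  exists W b, [/\ KG W, ple U W, G b, conjugates b V W
    & forall x, zdef S x -> b x = x].

Lemma amalgamates_ple S S' T :
  ple S S' -> amalgamates S' T -> amalgamates S T.
Proof.
move=> SS' am U V KU KV TU TV.
have [W [b [KW UW Gb VW bid]]] := am U V KU KV TU TV.
by exists W, b; split=> // x /(zdef_ple SS'); exact: bid.
Qed.

(** Conjugating [T0] back by an extension [t] of [tau] turns the embedding of [S] into an inclusion.
    Conjugating the amalgam [W0] back by [a] does the same for [U], and [V] is then mapped by
    [a^-1 b]. *)
Lemma WAP_amalgamates S : WAP St G -> KG S ->
  exists T, [/\ KG T, ple S T & amalgamates S T].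
Proof.
move=> wap KS; have [T0 [tau [KT0 tauST am]]] := wap S KS.
have [_ _ _ tau_dom _] := tauST.
have [t [Gt taut ST0]] := embedding_conjugates tauST.
have [u [Gu tK uK]] := group_inv Gt.
have [T [KT TE]] := KG_conj Gt KT0.
have ST : ple S T by move=> x y Sxy; apply/TE; exact: ST0.
exists T; split=> // U V KU KV TU TV.
have T0T V' : ple T V' -> embedding St G T0 V' (total_pmap u).
  move=> TV'; apply: conjugates_embedding => // x y T0xy.
  by apply: TV'; apply/TE; rewrite !uK.
have [W0 [phi [psi [KW0 phiU psiV eq_phipsi]]]] :=
  am U V _ _ KU KV (T0T U TU) (T0T V TV).
have [_ _ _ phi_dom _] := phiU; have [_ _ _ psi_dom _] := psiV.
have [a [Ga phia UW0]] := embedding_conjugates phiU.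
have [b [Gb psib VW0]] := embedding_conjugates psiV.
have [c [Gc aK cK]] := group_inv Ga.
have [W [KW WE]] := KG_conj Ga KW0.
exists W, (c \o b); split=> //.
- by move=> x y /UW0 W0xy; apply/WE.
- exact: group_comp.
- by move=> x y /VW0 W0xy; apply/WE; rewrite /= !cK.
move=> x Sx; have := eq_phipsi x Sx; rewrite /pcomp.
(* [u] cancels [t], so the amalgamation equation reduces to [a x = b x]. *)
have [x' taux] := tau_dom x Sx; rewrite taux /=.
have [<-] := taut x x' taux; rewrite tK.
have [y phix] := phi_dom x (zdef_ple TU (zdef_ple ST Sx)).
have [z psix] := psi_dom x (zdef_ple TV (zdef_ple ST Sx)).
rewrite phix psix /= => -[yz].
have [ax] := phia x y phix; have [bx] := psib x z psix.
by rewrite bx -yz -ax aK.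
Qed.

Lemma JEP_extension S T : JEP St G -> KG S -> KG T ->
  exists U b, [/\ KG U, ple T U, G b & conjugates b S U].
Proof.
move=> jep KS KT; have [U0 [KU0 [phi Sphi] [psi Tpsi]]] := jep S T KS KT.
have [a [Ga _ SU0]] := embedding_conjugates Sphi.
have [b [Gb _ TU0]] := embedding_conjugates Tpsi.
have [c [Gc bK cK]] := group_inv Gb.
have [U [KU UE]] := KG_conj Gb KU0.
exists U, (c \o a); split=> //; [|exact: group_comp|].
- by move=> x y /TU0 U0xy; apply/UE.
- by move=> x y /SU0 U0xy; apply/UE; rewrite /= !cK.
Qed.

(** The condition says that [g] extends [b S b^-1], again an element of [KG]. *)
Lemma conjugates_open S g b : KG S -> G g -> G b ->
  conjugates b S (total_pmap g) ->
  exists2 X, finite_set X & forall h, G h -> (forall x, X x -> h x = g x) ->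
    conjugates b S (total_pmap h).
Proof.
move=> KS Gg Gb Sg; have [c [Gc bK cK]] := group_inv Gb.
have [S' [KS' S'E]] := KG_conj Gc KS.
have S'g : ple S' (total_pmap g).
  by move=> x y /S'E /Sg; rewrite !cK.
have [X Xfin XS'] := KG_open KS' S'g Gg.
exists X => // h Gh hX x y Sxy.
by apply: (XS' h Gh hX); apply/S'E; rewrite !bK.
Qed.

End weakly_injective.

(** * The generic element is weakly injective *)

Theorem theorem3p3 (R : realType) (L : signature) (M : countType)
    (St : structure L M) (G : set (M -> M))
    (Ggroup : permutation_group G)
    (Gops : forall g, G g -> preserves_operations St g)
    (Gpolish : polish R (pointwise_space G))
    (jep : JEP St G) (wap : WAP St G) :
  exists2 Phi : M -> M, G Phi & weakly_KG_injective St G (total_pmap Phi).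
Proof.
have K0 : KG St G (restr id (smallest (substructure St) set0)).
  by apply: KG_restr => //; exact: group_id.
have [e [Ke esurj]] : exists e : nat -> Defs.pmap M,
    (forall n, KG St G (e n)) /\ (forall S, KG St G S -> exists n, e n = S).
  have := KG_countable Gops; rewrite /countable.
  move=> /pfcard_geP [K00|[f]]; first by move: K0; rewrite K00.
  exists f; split=> [n|S KS]; first exact: funS.
  by have [n _ <-] := 'surj_f KS; exists n.
(* The three families give universality, a suitable [T] above each [e n] below [g], and a map into
   [g] of each extension [e k] of such a [T = e m]. The premises make a condition hold trivially
   where it does not apply. *)
pose P (i : nat + nat + nat * nat * nat) (g : M -> M) : Prop :=
  match i with
  | inl (inl n) => exists2 b, G b & conjugates b (e n) (total_pmap g)
  | inl (inr n) => ple (e n) (total_pmap g) ->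
      exists T, [/\ KG St G T, ple (e n) T, ple T (total_pmap g)
        & amalgamates St G (e n) T]
  | inr (n, m, k) =>
      amalgamates St G (e n) (e m) -> ple (e m) (e k) ->
      ple (e m) (total_pmap g) ->
      exists2 b, G b & conjugates b (e k) (total_pmap g) /\
        forall x, zdef (e n) x -> b x = x
  end.
(* Failure to extend [S] shows at a single point, so it is an open condition too; this handles the
   premises in [P]. *)
have not_ple S g : ~ ple S (total_pmap g) -> exists2 X, finite_set X &
    forall h, (forall x, X x -> h x = g x) -> ~ ple S (total_pmap h).
  move=> nSg; have [x nSgx] :
      exists x, ~ forall y, S x = Some y -> Some (g x) = Some y.
    by apply/existsNP => Sg; apply: nSg => x y; exact: Sg.
  exists [set x]; first exact: finite_set1.
  move=> h hx Sh; apply: nSgx => y Sxy; rewrite -(hx x erefl); exact: Sh.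
have [|||Phi GPhi PhiP] := @polish_group_generic R M G _ P Gpolish.
- by exists id; exact: group_id.
- case=> [[n|n]|[[n m] k]] g Gg /=.
  + move=> [b Gb eb].
    have [X Xfin XP] := conjugates_open Ggroup Gops (Ke n) Gg Gb eb.
    by exists X => // h Gh hX; exists b => //; exact: XP.
  + have [eg /(_ eg) [T [KT eT Tg am]]|/not_ple [X Xfin XP] _] :=
      pselect (ple (e n) (total_pmap g)); last first.
      by exists X => // h _ /XP.
    have [X Xfin XP] := KG_open Gops KT Tg Gg.
    by exists X => // h Gh hX _; exists T; split=> //; exact: XP.
  + have [[am mk]|nmk] :=
      pselect (amalgamates St G (e n) (e m) /\ ple (e m) (e k)); last first.
      by exists set0; [exact: finite_set0|move=> h _ _ am mk; case: nmk].
    have [mg /(_ am mk mg) [b Gb [eb bid]]|/not_ple [X Xfin XP] _] :=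
      pselect (ple (e m) (total_pmap g)); last first.
      by exists X => // h _ /XP nh _ _ /nh.
    have [X Xfin XP] := conjugates_open Ggroup Gops (Ke k) Gg Gb eb.
    by exists X => // h Gh hX _ _ _; exists b => //; split=> //; exact: XP.
(* Density scheme: the values of [g] on [X] are stored in some [Q] below [g]; any element of [G]
   extending some [W] above [Q] keeps them. *)
- have ext_agree Q W g X : KG St G W -> ple Q W -> ple Q (total_pmap g) ->
      X `<=` pdom Q -> exists2 h, G h & ple W (total_pmap h) /\
        forall x, X x -> h x = g x.
    move=> [_ _ _ [h Gh Wh]] QW Qg XQ; exists h => //; split=> //.
    by apply: (ple_agree Qg XQ) => x y /QW; exact: Wh.
  case=> [[n|n]|[[n m] k]] g X Gg Xfin /=.
  + have [Q [KQ Qg XQ]] := KG_neighborhood Ggroup Gops Gg Xfin.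
    have [U [b [KU QU Gb eU]]] := JEP_extension Ggroup Gops jep (Ke n) KQ.
    have [h Gh [Uh hX]] := ext_agree _ _ _ _ KU QU Qg XQ.
    by exists h; split=> //; exists b => // x y /eU /Uh.
  + have [Q0 [KQ0 Q0g XQ0]] := KG_neighborhood Ggroup Gops Gg Xfin.
    (* Either some [h] agreeing with [g] on [X] extends [e n] and replaces [g], or [g] itself
       satisfies the condition vacuously. *)
    have [[h Gh [hX eh]]|nh] := pselect (exists2 h, G h &
        (forall x, X x -> h x = g x) /\ ple (e n) (total_pmap h)); last first.
      by exists g; split=> // eg; case: nh; exists g.
    have [Q [KQ eQ Qh XQ]] := KG_enlarge Ggroup Gops (Ke n) eh Gh Xfin.
    (* WAP is applied to [Q] rather than [e n], so that [T] also retains the values on [X];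
       amalgamation over [Q] is in particular over [e n]. *)
    have [T [KT QT am]] := WAP_amalgamates Ggroup Gops wap KQ.
    have [f Gf [Tf fX]] := ext_agree _ _ _ _ KT QT Qh XQ.
    exists f; split=> [//|x Xx|_]; first by rewrite fX // hX.
    exists T; split=> //; first by move=> x y /eQ /QT.
    exact: amalgamates_ple am.
  + have [[am mk]|nmk] :=
      pselect (amalgamates St G (e n) (e m) /\ ple (e m) (e k)); last first.
      by exists g; split=> // am mk; case: nmk.
    have [mg|nmg] := pselect (ple (e m) (total_pmap g)); last first.
      by exists g; split=> // _ _ /nmg.
    have [Q [KQ mQ Qg XQ]] := KG_enlarge Ggroup Gops (Ke m) mg Gg Xfin.
    (* Both [Q] and [e k] extend [e m]. Their amalgam contains [Q] itself, and [b] carries [e k]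
       into it while fixing [zdef (e n)]. *)
    have [W [b [KW QW Gb kW bid]]] := am _ _ KQ (Ke k) mQ mk.
    have [h Gh [Wh hX]] := ext_agree _ _ _ _ KW QW Qg XQ.
    exists h; split=> // _ _ _; exists b => //; split=> // x y /kW; exact: Wh.
exists Phi => //; split.
  move=> S /esurj [n <-]; have [b Gb Sb] := PhiP (inl (inl n)).
  by exists (total_pmap b); exact: conjugates_embedding.
move=> S /esurj [n <-] SPhi.
have [T [KT ST TPhi am]] := PhiP (inl (inr n)) SPhi; exists T; split=> //.
(* [T] is replaced by its index [m], so that the third family applies to it. *)
move: KT => /esurj [m mT]; move: mT ST TPhi am => <- ST TPhi am.
move=> U /esurj [k <-] TU.
have [b Gb [Ub bid]] := PhiP (inr (n, m, k)) am TU TPhi.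
exists (total_pmap b); first exact: conjugates_embedding.
by move=> x Sx; rewrite /total_pmap bid //; left.
Qed.
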